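(* Let $F$ be an $n$-dimensional Euclidean space with inner product $\langle\cdot,\cdot\rangle_F$, let $L\subseteq F$ be an even positive lattice of rank $n$ with basis $\{e_1,\dots,e_n\}$, and let $G=(G_{i,j})_{1\le i,j\le n}$, $G_{i,j}=\langle e_i,e_j\rangle_F$, be the Gram matrix. Let $[\omega_G]\in H^3_{\mathrm{Borel}}(\mathrm{U}(1)^n,\mathrm{U}(1))$ be the obstruction class of the $F/L$-kernel on $\mathcal{A}_L(I)$, transported to $\mathrm{U}(1)^n$ as described in the context. Then, as classes in $H^4_{\mathrm{Borel}}(\mathrm{U}(1)^n,\mathbb{Z})$, $$\delta_3([\omega_G])=\frac12\sum_{i}G_{i,i}\; b_i\wedge b_i+\sum_{i<j}G_{i,j}\; b_i\wedge b_j .$$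
   Context: Even lattice: $\langle x,x\rangle_F\in2\mathbb{Z}$ for all $x\in L$. Borel cohomology: $H^k_{\mathrm{Borel}}(T,A)$ (trivial action) is the cohomology of the complex of Borel maps $T^k\to A$ with the usual group cochain differential $\partial\omega(g_1,\dots,g_{k+1})=\omega(g_2,\dots,g_{k+1})+\sum_{j=1}^k(-1)^j\omega(g_1,\dots,g_jg_{j+1},\dots,g_{k+1})+(-1)^{k+1}\omega(g_1,\dots,g_k)$. $\delta_3\colon H^3_{\mathrm{Borel}}(\mathrm{U}(1)^n,\mathrm{U}(1))\to H^4_{\mathrm{Borel}}(\mathrm{U}(1)^n,\mathbb{Z})$ is the Bockstein (connecting) homomorphism of $0\to\mathbb{Z}\to\mathbb{R}\xrightarrow{t\mapsto e^{2\pi i t}}\mathrm{U}(1)\to1$. The kernel. $S^1=\mathbb{R}/2\pi\mathbb{Z}$; fix a proper (non-empty, open, connected, non-dense) interval $I\subset S^1$. Let $H_{0,F}$ be the completion of $C^\infty(S^1,F)/F$ for $\|f\|^2=\sum_{k\ge1}k\|\hat f_k\|^2$, with complex structure $\hat f_k\mapsto -i\,\mathrm{sign}(k)\hat f_k$ and $\omega([f],[g])=\mathrm{Im}\langle f,g\rangle=\frac12\int_0^{2\pi}\langle f,g'\rangle_F\frac{d\theta}{2\pi}$; let $W(\xi)$ be the Weyl unitaries on the Bosonic Fock space over $H_{0,F}$, with $W(\xi)W(\eta)=e^{-i\omega(\xi,\eta)}W(\xi+\eta)$ and vacuum expectation $e^{-\|\xi\|^2/2}$; and $\mathcal{A}_F(I)=\{W([f]):\mathrm{supp}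 f\subset I\}''$. Fix a smooth $\ell_0\colon S^1\to\mathbb{R}$ with support in $I$ and $\int_0^{2\pi}\ell_0\frac{d\theta}{2\pi}=1$. For $t\in F$, $\rho_t\in\mathrm{Aut}(\mathcal{A}_F(I))$ is given by $\rho_t(W([f]))=e^{i\int\langle f,t\ell_0\rangle_F\frac{d\theta}{2\pi}}W([f])$. Let $b\colon L\times L\to\{\pm1\}$ be the bicharacter with $b(e_i,e_j)=(-1)^{\langle e_i,e_j\rangle_F}$ if $i<j$ and $1$ otherwise. $\mathcal{A}_L(I)=\mathcal{A}_F(I)\rtimes_{\rho,b}L$ is the twisted crossed product, generated by $\iota(\mathcal{A}_F(I))$ and unitaries $\psi_m$ ($m\in L$) with $\psi_m\iota(a)=\iota(\rho_m(a))\psi_m$, $\psi_\ell\psi_m=b(\ell,m)\psi_{\ell+m}$. The braiding is $\varepsilon(\rho_p,\rho_q)=e^{i\pi\langle p,q\rangle_F}1$, and $\alpha$-induction gives automorphisms $\beta_t$ ($t\in F$) of $\mathcal{A}_L(I)$, $\beta_t(\iota(a)\psi_m)=\lambda(t,m)\,\iota(\rho_t(a))\psi_m$, where $\lambda(t,m)=e^{-i\pi\langle t,m\rangle_F}$ (for $\alpha^+$) or $\lambda(t,m)=e^{+i\pi\langle t,m\rangle_F}$ (for $\alpha^-$). Here the $\alpha^-$ choice is used. The $F/L$-kernel is $t+L\mapsto[\beta_t]\in\mathrm{Out}(\mathcal{A}_L(I))$. Its obstruction is the class of the 3-cocycle $\omega$ defined, for a Borel lift $\tilde\alpha$ and unitaries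 $u(g,h)$ with $\tilde\alpha_g\tilde\alpha_h=\mathrm{Ad}(u(g,h))\tilde\alpha_{gh}$, by $\tilde\alpha_g(u(h,k))u(g,hk)=\omega(g,h,k)u(g,h)u(gh,k)$. Explicit cocycle. Identify $\mathrm{U}(1)^n\cong\mathbb{R}^n/\mathbb{Z}^n\cong F/L$ by $(e^{2\pi i x_i})_i\leftrightarrow x+\mathbb{Z}^n\leftrightarrow\sum_ix_ie_i+L$. Let $s\colon\mathbb{R}^n/\mathbb{Z}^n\to[0,1)^n$ be the Borel section and $c(x,y)=s(x)+s(y)-s(x+y)\in\mathbb{Z}^n$. Put $\langle v,w\rangle_G=\sum_{i,j}v_iG_{i,j}w_j$ and $[v,w]_G=\sum_{i<j}v_iG_{i,j}w_j$. With the lift $\tilde\alpha_x=\beta_{s(x)}$ and $u(x,y)=\psi_{c(x,y)}$ (coordinates with respect to $e_1,\dots,e_n$), the obstruction cocycle is $$\omega_G(q,r,t)=(-1)^{[c(q,r),c(q+r,t)]_G-[c(r,t),c(q,r+t)]_G}\;e^{i\pi\langle s(q),c(r,t)\rangle_G}.$$ Generators. $b_i\colon \mathrm{U}(1)^n\times\mathrm{U}(1)^n\to\mathbb{Z}$ is the 2-cocycle $b_i(x,y)=c(x,y)_i$, the $i$-th coordinate of $c(x,y)$. For 2-cocycles, $(b_i\wedge b_j)(x_1,x_2,x_3,x_4)=b_i(x_1,x_2)b_j(x_3,x_4)$; in the claim $b_i\wedge b_j$ stands for its cohomology class. *)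

(* Defs.v *)
From HB Require Import structures.
From mathcomp Require Import all_boot all_order all_algebra.
From mathcomp Require Import sesquilinear generic_quotient ring_quotient.
From mathcomp Require Import complex.
From mathcomp Require Import all_classical all_reals all_analysis.
From mathcomp Require Import measurable_realfun.
From mathcomp Require Import ring lra.
Import numFieldNormedType.Exports.

Set Implicit Arguments.
Unset Strict Implicit.
Unset Printing Implicit Defensive.

Import Order.TTheory GRing.Theory Num.Theory.
Local Open Scope classical_set_scope.
Local Open Scope complex_scope.
Local Open Scope ring_scope.

Definition cis (R : realType) (t : R) : R[i] := cos t +i* sin t.

Record circle (R : realType) :=
  Circle { cval :> R[i]; circle_norm : `|cval| == 1 }.
HB.instance Definition _ (R : realType) := [isSub for @cval R].
HB.instance Definition _ (R : realType) := [Choice of circle R by <:].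

Section CircleGroup.
Variable R : realType.
Implicit Types z w : circle R.

Lemma circle1_proof : `|1 : R[i]| == 1. Proof. by rewrite normr1. Qed.
Lemma circleM_proof z w : `|(z : R[i]) * w| == 1.
Proof.
by rewrite normrM (eqP (circle_norm z)) (eqP (circle_norm w)) mulr1.
Qed.
Lemma circleV_proof z : `|(z : R[i])^-1| == 1.
Proof. by rewrite normfV (eqP (circle_norm z)) invr1. Qed.

Definition circle1 := Circle circle1_proof.
Definition circleM z w := Circle (circleM_proof z w).
Definition circleV z := Circle (circleV_proof z).

Lemma circleA : associative circleM.
Proof. by move=> x y z; apply/val_inj; rewrite /= mulrA. Qed.
Lemma circleC : commutative circleM.
Proof. by move=> x y; apply/val_inj; rewrite /= mulrC. Qed.
Lemma circle1M : left_id circle1 circleM.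
Proof. by move=> x; apply/val_inj; rewrite /= mul1r. Qed.
Lemma circleVM : left_inverse circle1 circleV circleM.
Proof.
move=> z; apply/val_inj; rewrite /= mulVf //.
by rewrite -normr_gt0 (eqP (circle_norm z)) ltr01.
Qed.

HB.instance Definition _ :=
  GRing.isZmodule.Build (circle R) circleA circleC circle1M circleVM.
HB.instance Definition _ := isPointed.Build (circle R) 0.

(* The Borel structure of the circle is the one induced from the plane *)
Definition circle_reim z : R * R := (complex.Re (z : R[i]), complex.Im (z : R[i])).
HB.instance Definition _ :=
  Measurable.copy (circle R)
    (g_sigma_algebra_preimageType (circle_reim : circle R -> (R * R)%type)).

Lemma measurable_circle_reim : measurable_fun setT circle_reim.
Proof. by move=> _ B mB; exists B. Qed.

End CircleGroup.


(* Coefficient groups: abelian groups with a Borel structure for which the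
   difference of two Borel maps is Borel. *)
HB.mixin Record hasBorel A of GRing.Zmodule A := {
  borel_set : set (set A);
  borel_map_sub_subproof : forall d (T : measurableType d) (f g : T -> A),
    (forall B, borel_set B -> measurable (f @^-1` B)) ->
    (forall B, borel_set B -> measurable (g @^-1` B)) ->
    forall B, borel_set B -> measurable ((fun t => f t - g t) @^-1` B)
}.
#[short(type="borelZmodType")]
HB.structure Definition BorelZmodule := {A of GRing.Zmodule A & hasBorel A}.

Definition borel_map d (T : measurableType d) (A : borelZmodType) (f : T -> A) :=
  forall B, borel_set B -> measurable (f @^-1` B).

Lemma measurable_int_op2 d (T : measurableType d) (op : int -> int -> int)
    (f g : T -> int) :
  (forall B : set int, measurable (f @^-1` B)) ->
  (forall B : set int, measurable (g @^-1` B)) ->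
  forall B : set int, measurable ((fun t => op (f t) (g t)) @^-1` B).
Proof.
move=> mf mg B.
have -> : (fun t => op (f t) (g t)) @^-1` B =
    \bigcup_(k in [set: int])
      (f @^-1` [set k] `&` g @^-1` [set l | B (op k l)]).
  apply/seteqP; split=> t /=; first by move=> Bt; exists (f t).
  by move=> [k _ [/= -> ]].
apply: countable_bigcupT_measurable => // k.
by apply: measurableI; [exact: mf|exact: mg].
Qed.

HB.instance Definition _ := @hasBorel.Build int [set: set int]
  (fun d T f g mf mg B _ => measurable_int_op2 (fun k l => k - l)
     (fun B => mf B I) (fun B => mg B I) B).

Section CircleBorel.
Variable R : realType.

Lemma measurable_circleP d (T : measurableType d) (f : T -> circle R) :
  measurable_fun setT f <->
  measurable_fun setT (fun t => complex.Re (f t : R[i])) /\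
  measurable_fun setT (fun t => complex.Im (f t : R[i])).
Proof.
split=> [mf|[mr mi] _ _ [B mB <-]].
  have mg : measurable_fun setT (@circle_reim R \o f).
    by apply: measurableT_comp => //; exact: measurable_circle_reim.
  by have /measurable_fun_pairP[] := mg.
rewrite setTI setTI; rewrite -[X in measurable X]setTI.
exact: (measurable_fun_pair mr mi).
Qed.

Lemma measurable_circleD d (T : measurableType d) (f g : T -> circle R) :
  measurable_fun setT f -> measurable_fun setT g ->
  measurable_fun setT (fun t => f t + g t).
Proof.
move=> /measurable_circleP[fr fi] /measurable_circleP[gr gi].
apply/measurable_circleP; split.
  rewrite (_ : (fun t => _) = fun t =>
      complex.Re (f t : R[i]) * complex.Re (g t : R[i]) -
      complex.Im (f t : R[i]) * complex.Im (g t : R[i])); last first.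
    by apply/funext => t /=; case: (cval (f t)) (cval (g t)) => ? ? [].
  by apply: measurable_funB; apply: measurable_funM.
rewrite (_ : (fun t => _) = fun t =>
    complex.Re (f t : R[i]) * complex.Im (g t : R[i]) +
    complex.Im (f t : R[i]) * complex.Re (g t : R[i])); last first.
  by apply/funext => t /=; case: (cval (f t)) (cval (g t)) => ? ? [].
by apply: measurable_funD; apply: measurable_funM.
Qed.

Lemma circleN_conj (z : circle R) : cval (- z) = (cval z)^*.
Proof.
have nz : cval z * (cval z)^* = 1.
  by rewrite -sqr_normc (eqP (circle_norm z)) expr1n.
have z0 : cval z != 0 by rewrite -normr_gt0 (eqP (circle_norm z)) ltr01.
by apply: (mulfI z0); rewrite nz /= mulfV.
Qed.

Lemma measurable_circleN d (T : measurableType d) (f : T -> circle R) :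
  measurable_fun setT f -> measurable_fun setT (fun t => - f t).
Proof.
move=> /measurable_circleP[fr fi]; apply/measurable_circleP; split.
  rewrite (_ : (fun t => _) = fun t => complex.Re (f t : R[i])) //.
  by apply/funext => t; rewrite circleN_conj; case: (cval (f t)).
rewrite (_ : (fun t => _) = fun t => - complex.Im (f t : R[i])).
  exact: measurable_funN.
by apply/funext => t; rewrite circleN_conj; case: (cval (f t)).
Qed.

Lemma circle_borel_sub d (T : measurableType d) (f g : T -> circle R) :
  (forall B, measurable B -> measurable (f @^-1` B)) ->
  (forall B, measurable B -> measurable (g @^-1` B)) ->
  forall B, measurable B -> measurable ((fun t => f t - g t) @^-1` B).
Proof.
move=> mf mg B mB; rewrite -[X in measurable X]setTI.
by apply: measurable_circleD => //; [|apply: measurable_circleN];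
  move=> _ C mC; rewrite setTI; [exact: mf|exact: mg].
Qed.

HB.instance Definition _ :=
  hasBorel.Build (circle R) (@circle_borel_sub).

Lemma circle_borelP d (T : measurableType d) (f : T -> circle R) :
  borel_map f <-> measurable_fun setT f.
Proof.
split=> mf; first by move=> _ B mB; rewrite setTI; exact: mf.
by move=> B mB; rewrite -[X in measurable X]setTI; exact: mf.
Qed.

End CircleBorel.

Section Cohomology.
Variables (d : measure_display) (T : measurableType d) (mul : T -> T -> T).

Section Differential.
Variables (A : zmodType) (k : nat).

(* [face j g] replaces the consecutive entries g_j, g_(j+1) by their product;
   indices start from 0. *)
Definition face (j : 'I_k) (g : k.+1.-tuple T) : k.-tuple T :=
  [tuple if (i < j)%N then tnth g (widen_ord (leqnSn k) i)
         else if i == j then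
           mul (tnth g (widen_ord (leqnSn k) i)) (tnth g (lift ord0 i))
         else tnth g (lift ord0 i) | i < k].

Definition face_last (g : k.+1.-tuple T) : k.-tuple T :=
  [tuple tnth g (widen_ord (leqnSn k) i) | i < k].

Definition cobord (f : k.-tuple T -> A) (g : k.+1.-tuple T) : A :=
  f [tuple of behead g]
  + \sum_(j < k) f (face j g) *~ (-1) ^+ j.+1
  + f (face_last g) *~ (-1) ^+ k.+1.

Lemma cobordB f1 f2 g : cobord (f1 - f2) g = cobord f1 g - cobord f2 g.
Proof.
rewrite /cobord !opprD !fctE mulrzBl.
have -> : \sum_(j < k) (f1 - f2) (face j g) *~ (-1) ^+ j.+1 =
    \sum_(j < k) f1 (face j g) *~ (-1) ^+ j.+1
    - \sum_(j < k) f2 (face j g) *~ (-1) ^+ j.+1.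
  by rewrite -sumrB; apply: eq_bigr => j _; rewrite !fctE mulrzBl.
by rewrite (addrACA (f1 _)) [LHS]addrACA.
Qed.

Lemma cobord0 g : cobord 0 g = 0.
Proof. by have := cobordB 0 0 g; rewrite !subrr. Qed.

End Differential.

Variable A : borelZmodType.

Definition is_cocycle k (f : k.-tuple T -> A) :=
  borel_map f /\ forall g, cobord f g = 0.

Definition cocycle_pred k : {pred k.-tuple T -> A} :=
  fun f => `[<is_cocycle f>].

Record cocycle k :=
  Cocycle { cocycle_fun :> k.-tuple T -> A; cocycleP : cocycle_pred cocycle_fun }.
HB.instance Definition _ k := [isSub for @cocycle_fun k].
HB.instance Definition _ k := [Choice of cocycle k by <:].

Lemma cocycle_zmod_closed k : zmod_closed (@cocycle_pred k).
Proof.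
split=> [|f1 f2].
  apply/asboolP; split=> [B mB|g]; last exact: cobord0.
  by rewrite preimage_cst; case: ifP.
move=> /asboolP[b1 c1] /asboolP[b2 c2]; apply/asboolP; split=> [|g].
  exact: borel_map_sub_subproof.
by rewrite cobordB c1 c2 subrr.
Qed.
HB.instance Definition _ k :=
  GRing.isZmodClosed.Build _ _ (@cocycle_zmod_closed k).
HB.instance Definition _ k := [SubChoice_isSubZmodule of cocycle k by <:].

(* In degree 0 there are no nonzero coboundaries. *)
Definition is_coboundary k : (k.-tuple T -> A) -> Prop :=
  match k with
  | 0 => fun f => f = 0
  | k'.+1 => fun f => exists2 h : k'.-tuple T -> A,
      borel_map h & forall g, f g = cobord h g
  end.

Definition coboundary k : {pred cocycle k} :=
  fun f => `[<is_coboundary f>].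

Lemma coboundary_zmod_closed k : zmod_closed (@coboundary k).
Proof.
split=> [|f1 f2].
  apply/asboolP; case: k => [//|k] /=; exists 0 => [B mB|g].
    by rewrite preimage_cst; case: ifP.
  by rewrite cobord0.
move=> /asboolP + /asboolP; case: k f1 f2 => [|k] f1 f2.
  move=> /= f10 f20; apply/asboolP => /=.
  by rewrite f10 f20 subrr.
move=> [h1 b1 c1] [h2 b2 c2]; apply/asboolP; exists (h1 - h2) => [|g].
  exact: borel_map_sub_subproof.
by rewrite cobordB -c1 -c2.
Qed.
HB.instance Definition _ k :=
  GRing.isZmodClosed.Build _ _ (@coboundary_zmod_closed k).

Definition cohomology k := Quotient.quot (@coboundary k).
HB.instance Definition _ k := GRing.Zmodule.on (cohomology k).

Definition cclass k (f : cocycle k) : cohomology k := (\pi f)%qT.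

End Cohomology.

Section CupProduct.
Variables (d : measure_display) (T : measurableType d) (mul : T -> T -> T).

Lemma cobord2E (A : zmodType) (f : 2.-tuple T -> A) x y z :
  cobord mul f [tuple x; y; z] =
  f [tuple y; z] - f [tuple mul x y; z] + f [tuple x; mul y z] - f [tuple x; y].
Proof.
rewrite /cobord !big_ord_recl big_ord0 addr0 /=.
rewrite !exprS expr0 !mulr1 !mulrNN !mulr1 !mulrNz !mulr1z !addrA.
congr (f _ - f _ + f _ - f _); apply: eq_from_tnth => i;
  rewrite ?tnth_mktuple; case: i => [[|[|//]] ?] //=.
Qed.

Lemma cobord4E (A : zmodType) (f : 4.-tuple T -> A) x y z u v :
  cobord mul f [tuple x; y; z; u; v] =
  f [tuple y; z; u; v] - f [tuple mul x y; z; u; v]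
  + f [tuple x; mul y z; u; v] - f [tuple x; y; mul z u; v]
  + f [tuple x; y; z; mul u v] - f [tuple x; y; z; u].
Proof.
rewrite /cobord !big_ord_recl big_ord0 addr0 /=.
rewrite !exprS expr0 !mulr1 !mulrNN !mulr1 !mulrNz !mulr1z !addrA.
congr (f _ - f _ + f _ - f _ + f _ - f _); apply: eq_from_tnth => i;
  rewrite ?tnth_mktuple; case: i => [[|[|[|[|//]]]] ?] //=.
Qed.

Definition wedge_fun (f g : 2.-tuple T -> int) (x : 4.-tuple T) : int :=
  f [tuple tnth x (inord 0); tnth x (inord 1)]
  * g [tuple tnth x (inord 2); tnth x (inord 3)].

Lemma wedge_funE f g x1 x2 x3 x4 :
  wedge_fun f g [tuple x1; x2; x3; x4] = f [tuple x1; x2] * g [tuple x3; x4].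
Proof. by rewrite /wedge_fun !(tnth_nth x1) !inordK. Qed.

Lemma wedge_proof (f g : cocycle mul int 2) :
  cocycle_pred mul (wedge_fun f g).
Proof.
have /asboolP[bf cf] := cocycleP f; have /asboolP[bg cg] := cocycleP g.
apply/asboolP; split=> [B _|x].
  have mpair (i j : 'I_4) :
      measurable_fun setT (fun x : 4.-tuple T => [tuple tnth x i; tnth x j]).
    apply/measurable_fun_tnthP => -[[|[|//]] ?] /=; exact: measurable_tnth.
  by apply: measurable_int_op2 => C; rewrite -[X in measurable X]setTI;
    [exact: (mpair _ _ measurableT (f @^-1` C) (bf C I))
    |exact: (mpair _ _ measurableT (g @^-1` C) (bg C I))].
case: x => [[|x [|y [|z [|u [|v [|//]]]]]] //= sx].
rewrite [Tuple _](_ : _ = [tuple x; y; z; u; v]); last exact/val_inj.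
rewrite cobord4E !wedge_funE.
transitivity (cobord mul f [tuple x; y; z] * g [tuple u; v]
              + f [tuple x; y] * cobord mul g [tuple z; u; v]).
  by rewrite !cobord2E; ring.
by rewrite cf cg mul0r mulr0 addr0.
Qed.

Definition wedge (f g : cocycle mul int 2) : cocycle mul int 4 :=
  Cocycle (wedge_proof f g).

End CupProduct.

Section Torus.
Variable R : realType.

Lemma circle_expi_proof (t : R) : `|cis (2 * pi * t)| == 1.
Proof.
rewrite /cis normc_def /= cos2Dsin2 sqrtr1; apply/eqP; exact: rmorph1.
Qed.
Definition expi (t : R) : circle R := Circle (circle_expi_proof t).

Definition section_angle (z : R[i]) : R :=
  if 0 <= complex.Im z then acos (complex.Re z) / (2 * pi)
  else 1 - acos (complex.Re z) / (2 * pi).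

Let twopi0 : 2 * pi != 0 :> R.
Proof. by rewrite mulf_neq0 // ?pnatr_eq0 // gt_eqF // pi_gt0. Qed.

Lemma cos_2piB (x : R) : cos (2 * pi - x) = cos x.
Proof. by rewrite mulr_natl -cosN opprB -cosD2pi subrK. Qed.
Lemma sin_2piB (x : R) : sin (2 * pi - x) = - sin x.
Proof. by rewrite mulr_natl -opprB sinN -sinD2pi subrK. Qed.

Lemma section_angleK (t : R) : 0 <= t < 1 -> section_angle (expi t) = t.
Proof.
move=> /andP[t0 t1]; have p0 := pi_gt0 R; rewrite /section_angle /=.
have [th|th] := lerP (2 * t) 1.
  have tI : 0 <= 2 * pi * t <= pi.
    have p2 : pi * (2 * t) <= pi * 1 by rewrite ler_pM2l.
    have p1 : 0 <= pi * t by rewrite mulr_ge0 // ltW.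
    by apply/andP; split; lra.
  by rewrite sin_ge0_pi // cosK ?in_itv //= mulrAC mulfV // mul1r.
have p1 : pi * 1 < pi * (2 * t) by rewrite ltr_pM2l.
have p2 : pi * t < pi * 1 by rewrite ltr_pM2l.
have tI : 0 < 2 * pi - 2 * pi * t < pi by apply/andP; split; lra.
have -> : 2 * pi * t = 2 * pi - (2 * pi - 2 * pi * t) by ring.
rewrite sin_2piB cos_2piB oppr_ge0 leNgt sin_gt0_pi //=.
rewrite cosK; last by rewrite in_itv /=; case/andP: tI => a b; rewrite !ltW.
by rewrite mulrBl mulfV // mulrAC mulfV // mul1r; ring.
Qed.

Lemma section_angleP (z : circle R) :
  0 <= section_angle z < 1 /\ expi (section_angle z) = z.
Proof.
have p0 := pi_gt0 R.
case: z => -[a b] /= n1.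
have ab : a ^+ 2 + b ^+ 2 = 1.
  have := n1; rewrite normc_def /= => /eqP/(congr1 (@complex.Re R)) /= s1.
  by rewrite -[LHS]sqr_sqrtr ?addr_ge0 ?sqr_ge0 // s1 expr1n.
have aI : -1 <= a <= 1 by apply/andP; split; nra.
have A0 := acos_ge0 aI; have Ap := acos_lepi aI.
rewrite /section_angle /=.
have ca : cos (acos a) = a by rewrite acosK // in_itv.
have sa : sin (acos a) = `|b|.
  by rewrite sin_acos // -sqrtr_sqr; congr Num.sqrt; rewrite -ab; ring.
have [b0|b0] := leP 0 b.
  split.
    apply/andP; split; first by apply: divr_ge0 => //; lra.
    by rewrite ltr_pdivrMr; lra.
  apply/val_inj; rewrite /= /cis mulrCA mulfV // mulr1 ca sa ger0_norm //.
have A1 : 0 < acos a.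
  by apply: acos_gt0; case/andP: aI => -> /=; nra.
split.
  apply/andP; split; first by rewrite subr_ge0 ler_pdivrMr; lra.
  by rewrite gtrBl; apply: divr_gt0 => //; lra.
apply/val_inj; rewrite /= /cis mulrBr mulr1 mulrCA mulfV // mulr1.
by rewrite cos_2piB sin_2piB ca sa ltr0_norm // opprK.
Qed.

(* The section s : R/Z -> [0, 1), through U(1) = R/Z *)
Definition sec (z : circle R) : R :=
  xget 0 [set t | 0 <= t < 1 /\ expi t = z].

Lemma secE z : sec z = section_angle z.
Proof.
have [t01 tz] := section_angleP z.
rewrite /sec; apply: xget_unique => // t [t1 <-].
by rewrite section_angleK.
Qed.

Lemma secP z : 0 <= sec z < 1 /\ expi (sec z) = z.
Proof. by rewrite secE; exact: section_angleP. Qed.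

Lemma measurable_sec : measurable_fun setT sec.
Proof.
rewrite (_ : sec = fun z => section_angle z); last by apply/funext => z; exact: secE.
have [mr mi] := (measurable_circleP (@id (circle R))).1 (@measurable_id _ _ setT).
have ma : measurable_fun setT (fun z : circle R => acos (complex.Re (z : R[i]))).
  have := (@measurable_comp _ _ _ _ _ _ (`[-1, 1]%classic : set R) (@acos R) setT
    (fun z : circle R => complex.Re (z : R[i]))).
  apply => //.
    move=> _ [[[a b] n1] _ <-] /=.
    have := n1; rewrite normc_def /= => /eqP/(congr1 (@complex.Re R)) /= s1.
    have ab : a ^+ 2 + b ^+ 2 = 1.
      by rewrite -[LHS]sqr_sqrtr ?addr_ge0 ?sqr_ge0 // s1 expr1n.
    by rewrite in_itv /=; apply/andP; split; nra.
  apply: (@measurable_fun_itv_cc _ _ _ false true).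
  apply: open_continuous_measurable_fun => //.
  move=> x. rewrite inE /= in_itv /= => xI; exact: continuous_acos.
apply: measurable_fun_ifT.
- exact: measurable_fun_ler.
- by apply: measurable_funM.
- by apply: measurable_funB => //; apply: measurable_funM.
Qed.


Lemma secD_int (z w : circle R) : exists k : int, sec z + sec w - sec (z + w) = k%:~R.
Proof.
have [/andP[z0 z1] ez] := secP z; have [/andP[w0 w1] ew] := secP w.
have expiD s t : expi (s + t) = expi s + expi t.
  apply/val_inj; rewrite /= /cis mulrDr cosD sinD.
  by apply/eqP; rewrite eq_complex /= eqxx addrC mulrC (mulrC (sin _)) eqxx.
have [lt1|ge1] := ltP (sec z + sec w) 1.
  have e : sec (z + w) = sec z + sec w.
    rewrite -[in LHS]ez -[in LHS]ew -expiD secE section_angleK //.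
    by rewrite addr_ge0.
  by exists 0; rewrite e subrr.
have e : sec (z + w) = sec z + sec w - 1.
  have p1 : expi (-1) = 0.
    apply/val_inj; rewrite /= /cis mulrN1 cosN sinN mulr_natl cos2pi sin2pi.
    by rewrite oppr0.
  rewrite -[in LHS]ez -[in LHS]ew -[LHS](congr1 sec (addr0 _)) -p1 -!expiD.
  by rewrite secE section_angleK //; apply/andP; split; lra.
by exists 1; rewrite e opprB addrC subrK.
Qed.

Variable n : nat.

Definition torus := n.-tuple (circle R).
HB.instance Definition _ := Measurable.on torus.

Definition torusM (x y : torus) : torus := [tuple tnth x i + tnth y i | i < n].

(* c(x, y) = s(x) + s(y) - s(x + y), which is integral *)
Definition carry (x y : torus) (i : 'I_n) : int :=
  Num.floor (sec (tnth x i) + sec (tnth y i) - sec (tnth (torusM x y) i)).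

Lemma carryE x y i : (carry x y i)%:~R =
  sec (tnth x i) + sec (tnth y i) - sec (tnth (torusM x y) i).
Proof.
rewrite /carry tnth_mktuple.
by have [k ->] := secD_int (tnth x i) (tnth y i); rewrite intrKfloor.
Qed.

Lemma torusMA : associative torusM.
Proof. by move=> x y z; apply/eq_from_tnth => i; rewrite !tnth_mktuple addrA. Qed.

Lemma carry_proof i :
  cocycle_pred torusM (fun x : 2.-tuple torus => carry (tnth x 0) (tnth x 1) i).
Proof.
apply/asboolP; split=> [B _|x].
  have m (j : 'I_2) : measurable_fun setT
      (fun x : 2.-tuple torus => tnth (tnth x j) i).
    by apply: (measurableT_comp (measurable_tnth i)); exact: measurable_tnth.
  pose f (x : 2.-tuple torus) : R := sec (tnth (tnth x 0) i)
    + sec (tnth (tnth x 1) i) - sec (tnth (tnth x 0) i + tnth (tnth x 1) i).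
  have mf : measurable_fun setT f.
    apply: measurable_funB; [apply: measurable_funD|];
      apply: (measurableT_comp measurable_sec) => //; exact: measurable_circleD.
  have -> : (fun x : 2.-tuple torus => carry (tnth x 0) (tnth x 1) i) @^-1` B
      = \bigcup_(k in [set: int]) (if k \in B then f @^-1` `[k%:~R, (k + 1)%:~R[ else set0).
    apply/seteqP; split=> x /=.
      rewrite /carry tnth_mktuple => Bx; exists (Num.floor (f x)) => //=.
      by rewrite mem_set //= in_itv /= floor_itv.
    move=> [k _]; case: ifPn => // /set_mem Bk /=; rewrite in_itv /= => fk.
    by rewrite /carry tnth_mktuple (floor_def fk).
  apply: countable_bigcupT_measurable => // k; case: ifP => // _.
  by rewrite -[X in measurable X]setTI; exact: mf.
case: x => [[|x [|y [|z [|//]]]] //= sx].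
rewrite [Tuple _](_ : _ = [tuple x; y; z]); last exact/val_inj.
rewrite cobord2E /tnth /=.
apply: (@intr_inj R); rewrite !(rmorphB, rmorphD) /= !carryE torusMA.
by rewrite !tnth_mktuple; ring.
Qed.

Definition gen_b (i : 'I_n) : cocycle torusM int 2 := Cocycle (carry_proof i).

(* Connecting homomorphism of 0 -> Z -> R -> U(1) -> 1: lift the U(1)-valued
   cocycle to a Borel real cochain and take its differential. *)
Definition connecting k (c : cohomology torusM (circle R) k)
    (h : cohomology torusM int k.+1) : Prop :=
  exists (om : cocycle torusM (circle R) k) (z : cocycle torusM int k.+1)
    (lft : k.-tuple torus -> R),
  [/\ c = cclass om, h = cclass z, measurable_fun setT lft,
      (forall x, expi (lft x) = om x)
    & forall x, cobord torusM lft x = (z x)%:~R].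

Definition bockstein k (c : cohomology torusM (circle R) k) :
    cohomology torusM int k.+1 :=
  xget 0 [set h | connecting c h].

End Torus.

Section HilbertSpaces.
Variable R : realType.

Definition ip_complete (H : lmodType R[i]) (ip : H -> H -> R[i]) : Prop :=
  forall u : nat -> H,
  (forall eps : R, 0 < eps -> exists N : nat, forall p q : nat,
     (N <= p)%N -> (N <= q)%N -> ip (u p - u q) (u p - u q) < eps%:C) ->
  exists l : H, forall eps : R, 0 < eps -> exists N : nat, forall p : nat,
     (N <= p)%N -> ip (u p - l) (u p - l) < eps%:C.

Record hilbertSpace := HilbertSpace {
  hspace :> lmodType R[i];
  hip : {dot hspace for @conjc R};
  hip_complete : ip_complete hip }.

Definition op (H : hilbertSpace) := H -> H.

Section Operators.
Variable H : hilbertSpace.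
Implicit Types (A B U : op H) (S M : set (op H)).

Definition bounded_op A : Prop :=
  linear A /\ exists c : R, forall x, hip H (A x) (A x) <= c%:C * hip H x x.

Definition adjoint_ops A B : Prop := forall x y, hip H (A x) y = hip H x (B y).

Definition unitary_op U : Prop :=
  [/\ linear U, forall x y, hip H (U x) (U y) = hip H x y
    & forall y, exists x, U x = y].

Definition scale_op (c : R[i]) A : op H := fun x => c *: A x.

Definition commutant S : set (op H) :=
  [set A | bounded_op A /\ forall B, S B -> A \o B = B \o A].

(* S'' for a self-adjoint set S of bounded operators *)
Definition vN_generated S : set (op H) := commutant (commutant S).

(* Automorphisms of the von Neumann algebra M; only the values on M matter. *)
Definition vN_automorphism M (alpha : op H -> op H) : Prop :=
  [/\ set_bij M M alpha,
      forall (c : R[i]) A B, M A -> M B ->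
        alpha (scale_op c A \+ B) = scale_op c (alpha A) \+ alpha B,
      forall A B, M A -> M B -> alpha (A \o B) = alpha A \o alpha B
    & forall A B, M A -> M B -> adjoint_ops A B ->
        adjoint_ops (alpha A) (alpha B)].

(* alpha = Ad(U) o beta on M *)
Definition eq_up_to_Ad M U (alpha beta : op H -> op H) : Prop :=
  forall A, M A -> alpha A \o U = U \o beta A.

Definition same_outer_class M (alpha beta : op H -> op H) : Prop :=
  exists U, [/\ M U, unitary_op U & eq_up_to_Ad M U alpha beta].

End Operators.
End HilbertSpaces.

Section Loops.
Variables (R : realType) (n : nat) (F : vectType R) (dotF : {dot F for idfun}).
Variable e : n.-tuple F.

(* Loops S^1 = R/2piZ -> V are 2pi-periodic maps R -> V; F-valued calculus is
   done on coordinates in the basis e. *)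
Definition smooth_periodic (h : R -> R) : Prop :=
  periodic h (2 * pi) /\ forall k x, derivable (derive1n k h) x 1.

Definition loop_coord (f : R -> F) (j : 'I_n) : R -> R :=
  fun x => coord e j (f x).

Definition smooth_loop (f : R -> F) : Prop :=
  forall j, smooth_periodic (loop_coord f j).

Definition loop_deriv (f : R -> F) : R -> F :=
  fun x => \sum_j derive1 (loop_coord f j) x *: tnth e j.

(* integral over the circle against dtheta / 2pi *)
Definition mean (h : R -> R) : R :=
  (2 * pi)^-1 * \int[lebesgue_measure]_(x in `[0, 2 * pi]) h x.

Definition meanF (f : R -> F) : F := \sum_j mean (loop_coord f j) *: tnth e j.

(* ||f^_k||^2 for f^_k = mean (f exp(-ik.)) in the complexification of F *)
Definition fourier_norm2 (f : R -> F) (k : nat) : R :=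
  let re := meanF (fun x => cos (k%:R * x) *: f x) in
  let im := meanF (fun x => - sin (k%:R * x) *: f x) in
  dotF re re + dotF im im.

Definition loop_norm2 (f : R -> F) : R :=
  limn (fun N : nat => \sum_(1 <= k < N) k%:R * fourier_norm2 f k).

Definition loop_omega (f g : R -> F) : R :=
  2^-1 * mean (fun x => dotF (f x) (loop_deriv g x)).

(* The arc of R/2piZ that is the image of ]a, b[, as a periodic subset of R *)
Definition circle_arc (a b : R) : set R :=
  [set x | exists k : int, a < x + 2 * pi * k%:~R < b].

Definition supported_in (V : zmodType) (f : R -> V) (I : set R) : Prop :=
  closure [set x | f x != 0] `<=` I.

(* The restriction to smooth loops of the Weyl operators on the Fock space over
   H_(0,F). The Weyl relations, the vacuum expectation and cyclicity of the vacuum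
   determine (H, vac, W) up to unitary equivalence. *)
Definition fock_weyl (H : hilbertSpace R) (vac : H) (W : (R -> F) -> op H) : Prop :=
  [/\ forall f, smooth_loop f -> unitary_op (W f),
      forall f g, smooth_loop f -> smooth_loop g ->
        W f \o W g = scale_op (cis (- loop_omega f g)) (W (f \+ g)),
      forall f, smooth_loop f ->
        hip H vac (W f vac) = (expR (- (loop_norm2 f / 2)))%:C
    & forall x, (forall f, smooth_loop f -> hip H (W f vac) x = 0) -> x = 0].

Definition local_algebra (H : hilbertSpace R) (W : (R -> F) -> op H) (I : set R) :
    set (op H) :=
  vN_generated [set A | exists f,
    [/\ smooth_loop f, supported_in f I & A = W f]].

Definition lattice : set F :=
  [set v | exists m : 'I_n -> int, v = \sum_i (m i)%:~R *: tnth e i].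

Definition even_lattice : Prop :=
  forall v, lattice v -> exists k : int, dotF v v = (2 * k)%:~R.

Variable G : 'M[int]_n.

Definition twist_bichar (b : F -> F -> R[i]) : Prop :=
  [/\ forall l m, lattice l -> lattice m -> b l m = 1 \/ b l m = -1,
      forall l l' m, lattice l -> lattice l' -> lattice m ->
        b (l + l') m = b l m * b l' m,
      forall l m m', lattice l -> lattice m -> lattice m' ->
        b l (m + m') = b l m * b l m'
    & forall i j : 'I_n, b (tnth e i) (tnth e j) =
        if (i < j)%N then (-1) ^ G i j else 1].

(* (K, iota, psi) is unitarily equivalent to the regular covariant representation
   on l^2(L, H), V being the inclusion of H as the summand at 0. *)
Definition crossed_product_rep (H : hilbertSpace R) (M : set (op H))
    (rho : F -> op H -> op H) (b : F -> F -> R[i])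
    (K : hilbertSpace R) (iota : op H -> op K) (psi : F -> op K) : Prop :=
  [/\ [/\ forall A, M A -> bounded_op (iota A),
      iota id = id,
      forall c A B, M A -> M B ->
        iota (scale_op c A \+ B) = scale_op c (iota A) \+ iota B,
      forall A B, M A -> M B -> iota (A \o B) = iota A \o iota B
    & forall A B, M A -> M B -> adjoint_ops A B ->
        adjoint_ops (iota A) (iota B)],
      forall m, lattice m -> unitary_op (psi m),
      forall m A, lattice m -> M A -> psi m \o iota A = iota (rho m A) \o psi m,
      forall l m, lattice l -> lattice m ->
        psi l \o psi m = scale_op (b l m) (psi (l + m))
    & exists V : H -> K,
      [/\ linear V, forall x y, hip K (V x) (V y) = hip H x y,
          forall A, M A -> iota A \o V = V \o A,
          forall l m x y, lattice l -> lattice m -> l <> m ->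
            hip K (psi l (V x)) (psi m (V y)) = 0
        & forall y, (forall m x, lattice m -> hip K (psi m (V x)) y = 0) -> y = 0]].

Definition crossed_product (H : hilbertSpace R) (M : set (op H))
    (K : hilbertSpace R) (iota : op H -> op K) (psi : F -> op K) : set (op K) :=
  vN_generated ([set A | exists2 B, M B & A = iota B]
                `|` [set A | exists2 m, lattice m & A = psi m]).

Record kernel_data (a b : R) (l0 : R -> R) := KernelData {
  kH : hilbertSpace R;
  kvac : kH;
  kW : (R -> F) -> op kH;
  kWP : fock_weyl kvac kW;
  kAF := local_algebra kW (circle_arc a b);

  krho : F -> op kH -> op kH;
  krho_aut : forall t, vN_automorphism kAF (krho t);
  krho_weyl : forall t f, smooth_loop f -> supported_in f (circle_arc a b) ->
    krho t (kW f) = scale_op (cis (mean (fun x => dotF (f x) (l0 x *: t)))) (kW f);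

  kb : F -> F -> R[i];
  kbP : twist_bichar kb;
  kK : hilbertSpace R;
  kiota : op kH -> op kK;
  kpsi : F -> op kK;
  kAL_rep : crossed_product_rep kAF krho kb kiota kpsi;
  kAL := crossed_product kAF kiota kpsi;

  (* alpha-induction, negative choice *)
  kbeta : F -> op kK -> op kK;
  kbeta_aut : forall t, vN_automorphism kAL (kbeta t);
  kbetaE : forall t A m, kAF A -> lattice m ->
    kbeta t (kiota A \o kpsi m) =
    scale_op (cis (pi * dotF t m)) (kiota (krho t A) \o kpsi m) }.

Arguments kAL {a b l0} _ _.
Arguments kbeta {a b l0} _ _ _.
Arguments kpsi {a b l0} _ _ _.

Section Obstruction.
Variables (a b : R) (l0 : R -> R) (D : kernel_data a b l0).
Implicit Types (al : torus R n -> op (kK D) -> op (kK D))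
  (u : torus R n -> torus R n -> op (kK D)).

(* F -> F/L = U(1)^n *)
Definition torus_of (t : F) : torus R n := [tuple expi (coord e i t) | i < n].

Definition borel_complex d (T : measurableType d) (f : T -> R[i]) : Prop :=
  measurable_fun setT (fun x => complex.Re (f x)) /\
  measurable_fun setT (fun x => complex.Im (f x)).

Definition kernel_lift al u : Prop :=
  [/\ forall t, vN_automorphism (kAL D) (al (torus_of t)) /\
        same_outer_class (kAL D) (al (torus_of t)) (kbeta D t),
      forall A x y, kAL D A -> borel_complex (fun g => hip (kK D) (al g A x) y),
      forall g h, kAL D (u g h) /\ unitary_op (u g h),
      forall x y, borel_complex
        (fun gh : torus R n * torus R n => hip (kK D) (u gh.1 gh.2 x) y)
    & forall g h, eq_up_to_Ad (kAL D) (u g h)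
        (al g \o al h) (al (torusM g h))].

Definition obstruction_cocycle al u
    (om : torus R n -> torus R n -> torus R n -> circle R) : Prop :=
  forall g h k, al g (u h k) \o u g (torusM h k) =
    scale_op (om g h k) (u g h \o u (torusM g h) k).

Definition secF (x : torus R n) : F := \sum_i sec (tnth x i) *: tnth e i.
Definition carryF (x y : torus R n) : F :=
  \sum_i (carry x y i)%:~R *: tnth e i.

End Obstruction.

Definition formG (v w : 'I_n -> R) : R := \sum_i \sum_j v i * (G i j)%:~R * w j.
Definition upperG (v w : 'I_n -> int) : int :=
  \sum_(i < n) \sum_(j < n | (i < j)%N) v i * G i j * w j.

Definition omegaG (q r t : torus R n) : R[i] :=
  (-1) ^ (upperG (carry q r) (carry (torusM q r) t)
          - upperG (carry r t) (carry q (torusM r t)))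
  * cis (pi * formG (fun i => sec (tnth q i)) (fun i => (carry r t i)%:~R)).

End Loops.
Arguments kAL {R n F dotF e G a b l0} _ _.
Arguments kbeta {R n F dotF e G a b l0} _ _ _.
Arguments kpsi {R n F dotF e G a b l0} _ _ _.
Arguments kernel_lift {R n F dotF e G a b l0} D al u.
Arguments obstruction_cocycle {R n F dotF e G a b l0} D al u om.

(* Main.v *)
(* Write [omega_G = exp(2 pi i phi)] with the Borel real cochain
   [phi(q,r,t) = (E(q,r,t) + <s(q), c(r,t)>_G) / 2], where
   [E(q,r,t) = [c(q,r), c(qr,t)]_G - [c(r,t), c(q,rt)]_G]. Since [ds = c] and
   [dc = 0], the differential of [<s, c>_G] is [<c, c>_G], the sum over all [i, j]
   of [G_ij b_i b_j]. [E] is a combination of cup-1 products, so [dE] is the sum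
   over [i < j] of [G_ij (b_i b_j - b_j b_i)]. Hence [d phi] is, already as a
   cochain, the sum of the [(G_ii / 2) b_i b_i] and the [G_ij b_i b_j], [i < j]. *)
Require Import Defs.
From HB Require Import structures.
From mathcomp Require Import ssrAC all_boot all_order all_algebra.
From mathcomp Require Import sesquilinear complex ring_quotient.
From mathcomp Require Import all_classical all_reals all_analysis.
From mathcomp Require Import measurable_realfun ring lra.
Import numFieldNormedType.Exports.
Import Order.TTheory GRing.Theory Num.Theory.
Local Open Scope classical_set_scope.
Local Open Scope ring_scope.

Set Implicit Arguments.
Unset Strict Implicit.

(** * Exponentials: [cis], and [expi] as a homomorphism with kernel the integers *)

Lemma cisD (R : realType) (s t : R) : cis (s + t) = cis s * cis t.
Proof.
apply/eqP; rewrite /cis cosD sinD eq_complex /= eqxx /=.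
by rewrite addrC mulrC (mulrC (sin s)).
Qed.

Lemma cis_pi_int (R : realType) (k : int) : cis (pi * k%:~R : R) = (-1) ^ k.
Proof.
have cis0 : cis (0 : R) = 1 by rewrite /cis cos0 sin0.
have cispi : cis (pi : R) = -1.
  by apply/eqP; rewrite /cis cospi sinpi eq_complex /= oppr0 !eqxx.
have nat m : cis (pi * m%:R : R) = (-1) ^+ m.
  elim: m => [|m IH]; first by rewrite mulr0 cis0 expr0.
  by rewrite -addn1 natrD mulrDr mulr1 cisD IH cispi exprD expr1.
case: k => m; first exact: nat.
(* A negative exponent reduces to a positive one by multiplying both sides by the nonzero value at
   the opposite integer. *)
rewrite NegzE -exprnN -nat; apply: (@mulfI _ (cis (pi * m.+1%:R : R))).
  by rewrite nat expf_neq0 // oppr_eq0 oner_eq0.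
rewrite -cisD mulrNz mulrN addrN cis0 mulfV //.
by rewrite nat expf_neq0 // oppr_eq0 oner_eq0.
Qed.

Lemma expiB (R : realType) : zmod_morphism (@expi R).
Proof.
have expiD : {morph @expi R : s t / s + t}.
  by move=> s t; apply/val_inj; rewrite /= mulrDr cisD.
by move=> s t; apply: (@addIr _ (expi t)); rewrite -expiD !subrK.
Qed.

HB.instance Definition _ (R : realType) :=
  GRing.isZmodMorphism.Build R (circle R) (@expi R) (@expiB R).

Lemma expi_int (R : realType) (k : int) : expi (k%:~R : R) = 0.
Proof.
apply/val_inj => /=.
have -> : 2 * pi * k%:~R = pi * (2 * k)%:~R :> R by rewrite intrM; ring.
by rewrite cis_pi_int -exprz_exp -exprnP sqrrN expr1n exp1rz.
Qed.

(** Subtracting the floor leaves a number in [[0, 1)] with the same image; there [section_angle]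
    inverts [expi], so this number is 0. This is what makes differences of real lifts integral. *)
Lemma expi_eq0 (R : realType) (x : R) :
  expi x = 0 -> x = (Num.floor x)%:~R.
Proof.
move=> x0; apply/eqP; rewrite -subr_eq0; apply/eqP.
set y := x - _.
have y01 : 0 <= y < 1.
  have /andP[] := floor_itv x.
  by rewrite intrD /y => ? ?; apply/andP; split; lra.
rewrite -(section_angleK y01) expiB x0 expi_int subrr.
by rewrite -[0](raddf0 (@expi R)) section_angleK // lexx ltr01.
Qed.

Lemma measurable_expi (R : realType) : measurable_fun setT (@expi R).
Proof.
apply/measurable_circleP; split => /=.
  apply: continuous_measurable_fun => x; apply: continuous_comp.
    exact: (@mulrl_continuous R).
  exact: continuous_cos.
apply: continuous_measurable_fun => x; apply: continuous_comp.
  exact: (@mulrl_continuous R).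
exact: continuous_sin.
Qed.

(** * Cochain algebra: explicit differentials, naturality, and additivity of classes *)

Lemma tuple4E (T : Type) (t : 4.-tuple T) :
  t = [tuple tnth t (inord 0); tnth t (inord 1);
             tnth t (inord 2); tnth t (inord 3)].
Proof.
apply: eq_from_tnth => -[[|[|[|[|//]]]] i4];
  by rewrite {2}/tnth /=; congr (tnth t _); apply/val_inj; rewrite /= inordK.
Qed.

Lemma cobord3E (d : measure_display) (T : measurableType d) (mul : T -> T -> T)
    (A : zmodType) (f : 3.-tuple T -> A) x y z u :
  cobord mul f [tuple x; y; z; u] =
  f [tuple y; z; u] - f [tuple mul x y; z; u] + f [tuple x; mul y z; u]
  - f [tuple x; y; mul z u] + f [tuple x; y; z].
Proof.
rewrite /cobord !big_ord_recl big_ord0 addr0 /=.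
rewrite !exprS expr0 !mulr1 !mulrNN !mulr1 !mulrNz !mulr1z !addrA.
congr (f _ - f _ + f _ - f _ + f _); apply: eq_from_tnth => i;
  rewrite ?tnth_mktuple; case: i => [[|[|[|//]]] ?] //=.
Qed.

(** Naturality of the differential in the coefficients, needed for [expi] and for the inclusion of
    the integers into the reals. *)
Lemma raddf_cobord (d : measure_display) (T : measurableType d)
    (mul : T -> T -> T) (A B : zmodType) (phi : {additive A -> B}) k
    (f : k.-tuple T -> A) g :
  phi (cobord mul f g) = cobord mul (phi \o f) g.
Proof.
rewrite /cobord !raddfD raddf_sum raddfMz /=; congr (_ + _ + _).
by apply: eq_bigr => j _; rewrite raddfMz.
Qed.

Lemma cobordK2 (d : measure_display) (T : measurableType d)
    (mul : T -> T -> T) (A : zmodType) (f : 2.-tuple T -> A) g :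
  associative mul -> cobord mul (cobord mul f) g = 0.
Proof.
move=> mulA; rewrite (tuple4E g) cobord3E !cobord2E !mulA.
rewrite !opprD !opprK !addrA.
(* The twenty terms cancel in pairs; the permutation makes the pairs adjacent. *)
rewrite [LHS](ACl (1*5*9*2*3*13*17*4*6*10*14*7*8*18*11*15*19*12*16*20))/=.
by rewrite !addrK subrr.
Qed.

Lemma cclass_eqP (d : measure_display) (T : measurableType d)
    (mul : T -> T -> T) (A : borelZmodType) k (f g : cocycle mul A k) :
  cclass f = cclass g <-> is_coboundary mul (f - g).
Proof.
rewrite /cclass; split=> [fg|/asboolP fg].
  have /eqP := fg; rewrite -Quotient.idealrBE => /asboolP.
  exact.
by apply/eqP; rewrite -Quotient.idealrBE.
Qed.

Lemma cclass_is_zmod_morphism (d : measure_display) (T : measurableType d)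
    (mul : T -> T -> T) (A : borelZmodType) k :
  zmod_morphism (@cclass d T mul A k).
Proof. by move=> f g; rewrite /cclass; exact: raddfB. Qed.

HB.instance Definition _ (d : measure_display) (T : measurableType d)
    (mul : T -> T -> T) (A : borelZmodType) k :=
  GRing.isZmodMorphism.Build _ _ (@cclass d T mul A k)
    (@cclass_is_zmod_morphism d T mul A k).

(** Evaluation is packaged as an additive map so that it distributes over sums and integer multiples
    of cocycles. *)
Definition cocycle_eval (d : measure_display) (T : measurableType d)
    (mul : T -> T -> T) (A : borelZmodType) k (g : k.-tuple T)
    (f : cocycle mul A k) : A := f g.

Lemma cocycle_evalB (d : measure_display) (T : measurableType d)
    (mul : T -> T -> T) (A : borelZmodType) k (g : k.-tuple T) :
  zmod_morphism (@cocycle_eval d T mul A k g).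
Proof. by []. Qed.

HB.instance Definition _ (d : measure_display) (T : measurableType d)
    (mul : T -> T -> T) (A : borelZmodType) k (g : k.-tuple T) :=
  GRing.isZmodMorphism.Build (cocycle mul A k) A (@cocycle_eval d T mul A k g)
    (@cocycle_evalB d T mul A k g).

(** * Borel measurability of the cochain operations *)

Lemma borel_map_comp d1 d2 (T1 : measurableType d1) (T2 : measurableType d2)
    (A : borelZmodType) (f : T2 -> A) (g : T1 -> T2) :
  borel_map f -> measurable_fun setT g -> borel_map (f \o g).
Proof.
move=> bf mg B mB; rewrite comp_preimage -[X in measurable X]setTI.
exact/mg/bf.
Qed.

Lemma borel_map_int_op2 d (T : measurableType d) (op : int -> int -> int)
    (f g : T -> int) :
  borel_map f -> borel_map g -> borel_map (fun t => op (f t) (g t)).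
Proof. by move=> mf mg B _; apply: measurable_int_op2 => C; [exact: mf|exact: mg]. Qed.

Lemma borel_map_int_sum d (T : measurableType d) (I : Type) (r : seq I)
    (P : pred I) (f : I -> T -> int) :
  (forall i, borel_map (f i)) -> borel_map (fun t => \sum_(i <- r | P i) f i t).
Proof.
move=> bf; elim: r => [|i r IH].
  by under eq_fun do rewrite big_nil; move=> B _; rewrite preimage_cst; case: ifP.
under eq_fun do rewrite big_cons; case: (P i) => //.
exact: (@borel_map_int_op2 _ _ +%R).
Qed.

Lemma measurable_intr d (T : measurableType d) (R : realType) (f : T -> int) :
  borel_map f -> measurable_fun setT (fun t => (f t)%:~R : R).
Proof.
by move=> bf _ B _; rewrite setTI (_ : _ @^-1` B = f @^-1` (intr @^-1` B)) //; apply: bf.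
Qed.

(** The preimage of a set of integers is a countable union of preimages of half-open unit
    intervals. *)
Lemma borel_map_floor d (T : measurableType d) (R : realType) (f : T -> R) :
  measurable_fun setT f -> borel_map (fun t => Num.floor (f t)).
Proof.
move=> mf B _.
have -> : (fun t => Num.floor (f t)) @^-1` B = \bigcup_(k in [set: int])
    (if k \in B then f @^-1` `[k%:~R, (k + 1)%:~R[ else set0).
  apply/seteqP; split=> t /=.
    by move=> Bt; exists (Num.floor (f t)) => //=; rewrite mem_set //= in_itv floor_itv.
  move=> [k _]; case: ifPn => // /set_mem Bk /=; rewrite in_itv /= => fk.
  by rewrite (floor_def fk).
apply: countable_bigcupT_measurable => // k; case: ifP => // _.
by rewrite -[X in measurable X]setTI; exact: mf.
Qed.

Lemma measurable_face d (T : measurableType d) (mul : T -> T -> T) k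
    (j : 'I_k) :
  measurable_fun setT (fun p : T * T => mul p.1 p.2) ->
  measurable_fun setT (face mul j).
Proof.
move=> mmul; apply/measurable_fun_tnthP => i /=.
under [X in measurable_fun _ X]eq_fun do rewrite /= tnth_mktuple.
case: (i < j)%N; first exact: measurable_tnth.
case: (i == j); last exact: measurable_tnth.
exact: (measurableT_comp mmul (measurable_fun_pair (measurable_tnth
  (widen_ord (leqnSn k) i)) (measurable_tnth (lift ord0 i)))).
Qed.

Lemma measurable_cobord d (T : measurableType d) (mul : T -> T -> T)
    (R : realType) k (f : k.-tuple T -> R) :
  measurable_fun setT (fun p : T * T => mul p.1 p.2) ->
  measurable_fun setT f -> measurable_fun setT (cobord mul f).
Proof.
move=> mmul mf; rewrite /cobord.
(* Integer multiples are turned into products with a constant, to which measurability of products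
   applies. *)
have mz (g : k.+1.-tuple T -> k.-tuple T) (c : int) : measurable_fun setT g ->
    measurable_fun setT (fun x => f (g x) *~ c).
  move=> mg; under [X in measurable_fun _ X]eq_fun do rewrite -mulrzr.
  by apply: measurable_funM; [exact: (measurableT_comp mf mg)|].
apply: measurable_funD; [apply: measurable_funD|].
- exact: (measurableT_comp mf (@measurable_behead _ _ _)).
- apply: (@measurable_sum _ _ _ _ _ _ (fun j x => f (face mul j x) *~ (-1) ^+ j.+1)) => j.
  by apply: (mz (face mul j)); exact: measurable_face.
- apply: (mz (@face_last _ _ k)); apply/measurable_fun_tnthP => i /=.
  under [X in measurable_fun _ X]eq_fun do rewrite /= tnth_mktuple.
  exact: measurable_tnth.
Qed.

Lemma measurable_torusM (R : realType) (n : nat) :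
  measurable_fun setT (fun p : torus R n * torus R n => torusM p.1 p.2).
Proof.
apply/measurable_fun_tnthP => i /=.
under [X in measurable_fun _ X]eq_fun do rewrite /= tnth_mktuple.
by apply: measurable_circleD; apply: (measurableT_comp (measurable_tnth i)).
Qed.

(** * The Bockstein computed from one lift *)

(* Two Borel real lifts of cohomologous cocycles differ, modulo a Borel integral
   cochain, by the differential of a Borel lift of the cobounding cochain. *)
Lemma bockstein3E (R : realType) (n : nat)
    (w : cocycle (@torusM R n) (circle R) 3) (z : cocycle (@torusM R n) int 4)
    (lft : 3.-tuple (torus R n) -> R) :
  measurable_fun setT lft -> (forall x, expi (lft x) = w x) ->
  (forall x, cobord (@torusM R n) lft x = (z x)%:~R) ->
  bockstein (cclass w) = cclass z.
Proof.
(* [bockstein] selects a class related to [cclass w]; the given lift shows that [cclass z] is one,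
   and the rest shows that it is the only one. *)
move=> mlft lftE zE; rewrite /bockstein; apply: xget_unique.
  by exists w, z, lft.
move=> _ [w' [z' [lft' [/esym ww' -> mlft' lft'E z'E]]]].
have /cclass_eqP[h bh hE] := ww'.
pose H x := sec (h x).
have mH : measurable_fun setT H.
  by apply: (measurableT_comp (@measurable_sec R)); exact/circle_borelP.
(* [P] exponentiates to [w' - w - dh = 0], hence is integral, and its differential is [z' - z]
   because [d(dH) = 0]. *)
pose P x := lft' x - lft x - cobord (@torusM R n) H x.
pose p x := Num.floor (P x).
have pE x : (p x)%:~R = P x.
  rewrite /p -expi_eq0 //; rewrite /P expiB [expi (lft' x - _)]expiB lft'E lftE.
  have -> : w' x - w x = cobord (@torusM R n) h x by rewrite -hE.
  apply/eqP; rewrite subr_eq0; apply/eqP/esym.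
  apply: etrans (raddf_cobord _ (@expi R) H x) _.
  by congr cobord; apply/funext => y /=; rewrite /H (secP (h y)).2.
have mP : measurable_fun setT P.
  apply: measurable_funB; first exact: measurable_funB.
  exact: (measurable_cobord (@measurable_torusM R n)).
apply/cclass_eqP; exists p; first exact: borel_map_floor.
move=> x; apply: (@intr_inj R).
apply: etrans (esym (raddf_cobord _ intr p x)).
have -> : intr \o p = lft' - lft - cobord (@torusM R n) H by exact/funext.
rewrite cobordB (cobordB _ lft' lft) cobordK2; last exact: torusMA.
by rewrite subr0 z'E zE raddfB.
Qed.

(** * Differential of the explicit real lift of [omegaG] *)

Lemma sum_pairs_upper (V : nmodType) n (a : 'I_n -> 'I_n -> V) :
  \sum_i \sum_j a i j =
  \sum_i a i i + \sum_(i < n) \sum_(j < n | (i < j)%N) (a i j + a j i).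
Proof.
have lower : \sum_(i < n) \sum_(j < n | (j < i)%N) a i j =
    \sum_(i < n) \sum_(j < n | (i < j)%N) a j i.
  by rewrite (exchange_big_dep xpredT).
transitivity (\sum_(i < n) (a i i + (\sum_(j < n | (i < j)%N) a i j
    + \sum_(j < n | (j < i)%N) a i j))).
  apply: eq_bigr => i _; rewrite (bigD1 i) //= (bigID (fun j : 'I_n => (i < j)%N)) /=.
  by congr (_ + (_ + _)); apply: eq_bigl => j; rewrite -val_eqE /=; case: ltngtP.
rewrite !big_split /= lower; congr (_ + _); rewrite -big_split /=.
by apply: eq_bigr => i _; rewrite big_split.
Qed.

(** The cocycle relation of [carry], solved for one term so that it can serve as a rewriting
    rule. *)
Lemma carry_assoc (R : realType) n (x y z : torus R n) i :
  carry x y i = carry y z i + carry x (torusM y z) i - carry (torusM x y) z i.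
Proof.
apply: (@intr_inj R); rewrite !(rmorphB, rmorphD) /= !carryE torusMA.
by ring.
Qed.

Lemma borel_carry d (T : measurableType d) (R : realType) n
    (f g : T -> torus R n) i :
  measurable_fun setT f -> measurable_fun setT g ->
  borel_map (fun t => carry (f t) (g t) i).
Proof.
move=> mf mg; have /asboolP[bb _] := cocycleP (gen_b R i).
apply: (borel_map_comp (g := fun t => [tuple f t; g t]) bb).
by apply/measurable_fun_tnthP => -[[|[|//]] ?].
Qed.

(** The exponent of the sign in [omegaG], kept as an integer so that it can be differentiated before
    reduction modulo 2. *)
Definition upper_cup1 (R : realType) n (G : 'M[int]_n) (q r t : torus R n) :=
  upperG G (carry q r) (carry (torusM q r) t)
  - upperG G (carry r t) (carry q (torusM r t)).

(* Steenrod's relation: the differential of a cup-1 product of cocycles is the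
   commutator of their cup product. *)
Lemma upper_cup1_cobord (R : realType) n (G : 'M[int]_n) (x y z u : torus R n) :
  upper_cup1 G y z u - upper_cup1 G (torusM x y) z u
  + upper_cup1 G x (torusM y z) u - upper_cup1 G x y (torusM z u)
  + upper_cup1 G x y z =
  upperG G (carry x y) (carry z u) - upperG G (carry z u) (carry x y).
Proof.
rewrite /upper_cup1 /upperG -!(sumrB, big_split) /=.
apply: eq_bigr => i _; rewrite -!(sumrB, big_split) /=.
apply: eq_bigr => j _; rewrite !torusMA.
(* These relations leave only the carries whose second argument is [u], [zu] or [yzu]; in them the
   identity is polynomial. *)
rewrite !(carry_assoc x y z) !(carry_assoc y z u) !(carry_assoc x (torusM y z) u).
rewrite !(carry_assoc (torusM x y) z u) !torusMA.
by ring.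
Qed.

Lemma formG_int (R : realType) n (G : 'M[int]_n) (v w : 'I_n -> int) :
  formG G (fun i => (v i)%:~R) (fun j => (w j)%:~R : R) =
  (\sum_i \sum_j v i * G i j * w j)%:~R.
Proof.
rewrite /formG rmorph_sum; apply: eq_bigr => i _; rewrite rmorph_sum.
by apply: eq_bigr => j _; rewrite !rmorphM.
Qed.

Definition omega_lift (R : realType) n (G : 'M[int]_n) (x : 3.-tuple (torus R n)) : R :=
  let q := tnth x (inord 0) in let r := tnth x (inord 1) in
  let t := tnth x (inord 2) in
  2^-1 * ((upper_cup1 G q r t)%:~R
    + formG G (fun i => sec (tnth q i)) (fun i => (carry r t i)%:~R)).

Lemma omega_liftE (R : realType) n (G : 'M[int]_n) (q r t : torus R n) :
  omega_lift G [tuple q; r; t] = 2^-1 * ((upper_cup1 G q r t)%:~R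
    + formG G (fun i => sec (tnth q i)) (fun i => (carry r t i)%:~R)).
Proof. by rewrite /omega_lift !(tnth_nth q) !inordK. Qed.

Lemma expi_omega_lift (R : realType) n (G : 'M[int]_n) (q r t : torus R n) :
  cval (expi (omega_lift G [tuple q; r; t])) = omegaG G q r t.
Proof.
rewrite omega_liftE /omegaG /=; set a := _%:~R; set b := formG _ _ _.
have -> : 2 * pi * (2^-1 * (a + b)) = pi * a + pi * b by field.
by rewrite cisD cis_pi_int.
Qed.

(** Leibniz rule: the carry in the second slot is closed, so only the differential of the section
    contributes, and that is the carry again. *)
Lemma formG_sec_cobord (R : realType) n (G : 'M[int]_n) (x y z u : torus R n) :
  let S q r t := formG G (fun i => sec (tnth q i)) (fun i => (carry r t i)%:~R) in
  S y z u - S (torusM x y) z u + S x (torusM y z) u - S x y (torusM z u) + S x y z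
  = formG G (fun i => (carry x y i)%:~R) (fun i => (carry z u i)%:~R).
Proof.
rewrite /formG /= -!(sumrB, big_split) /=.
apply: eq_bigr => i _; rewrite -!(sumrB, big_split) /=.
apply: eq_bigr => j _.
rewrite (carry_assoc y z u) (carryE x y) !(rmorphB, rmorphD) /=.
by ring.
Qed.

Lemma omega_lift_cobord (R : realType) n (G : 'M[int]_n)
    (symG : forall i j, G i j = G j i) (evenG : forall i, (2 %| G i i)%Z)
    (g : 4.-tuple (torus R n)) :
  cobord (@torusM R n) (omega_lift G) g =
  (\sum_i wedge_fun (gen_b R i) (gen_b R i) g *~ (G i i %/ 2)%Z
   + \sum_(i < n) \sum_(j < n | (i < j)%N)
       wedge_fun (gen_b R i) (gen_b R j) g *~ G i j)%:~R.
Proof.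
rewrite (tuple4E g); move: (tnth g (inord 0)) (tnth g (inord 1))
  (tnth g (inord 2)) (tnth g (inord 3)) => x y z u.
rewrite cobord3E !omega_liftE.
transitivity (2^-1 * ((upper_cup1 G y z u - upper_cup1 G (torusM x y) z u
  + upper_cup1 G x (torusM y z) u - upper_cup1 G x y (torusM z u)
  + upper_cup1 G x y z)%:~R
  + formG G (fun i => (carry x y i)%:~R) (fun i => (carry z u i)%:~R)) : R).
  by rewrite -formG_sec_cobord !(rmorphB, rmorphD) /=; ring.
rewrite upper_cup1_cobord formG_int sum_pairs_upper -rmorphD /=.
(* After doubling, everything is an integer. On the diagonal, evenness makes [G i i %/ 2] exact. For
   [i < j], symmetry of [G] turns the pairing into [G_ij (b_i b_j + b_j b_i)], and the commutator
   cancels [b_j b_i] while doubling [b_i b_j]. *)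
apply: (@mulfI _ 2); first by rewrite pnatr_eq0.
rewrite mulrA mulfV ?pnatr_eq0 // mul1r -[2 in RHS]/(2%:~R) -intrM; congr (_%:~R).
rewrite addrC -addrA mulrDr !mulr_sumr; congr (_ + _).
  apply: eq_bigr => i _; rewrite wedge_funE /= mulrzz -{1}(divzK (evenG i)).
  by rewrite !(tnth_nth x) /=; ring.
rewrite /upperG -!(sumrB, big_split) /=.
apply: eq_bigr => i _; rewrite mulr_sumr -!(sumrB, big_split) /=.
apply: eq_bigr => j _; rewrite wedge_funE /= mulrzz (symG j i).
by rewrite !(tnth_nth x) /=; ring.
Qed.

(** * The Borel cocycle [omega] and its Bockstein class *)

Lemma measurable_omega_lift (R : realType) n (G : 'M[int]_n) :
  measurable_fun setT (@omega_lift R n G).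
Proof.
have mt (i : 'I_3) : measurable_fun setT (fun x : 3.-tuple (torus R n) => tnth x i).
  exact: measurable_tnth.
have mM (i j : 'I_3) : measurable_fun setT
    (fun x : 3.-tuple (torus R n) => torusM (tnth x i) (tnth x j)).
  exact: (measurableT_comp (@measurable_torusM R n)
    (measurable_fun_pair (mt i) (mt j))).
have mupper (f1 f2 f3 f4 : 3.-tuple (torus R n) -> torus R n) :
    measurable_fun setT f1 -> measurable_fun setT f2 ->
    measurable_fun setT f3 -> measurable_fun setT f4 ->
    borel_map (fun x => upperG G (carry (f1 x) (f2 x)) (carry (f3 x) (f4 x))).
  move=> m1 m2 m3 m4.
  apply: borel_map_int_sum => i; apply: borel_map_int_sum => j.
  apply: (@borel_map_int_op2 _ _ (fun k l => k * G i j * l)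
    (fun x => carry (f1 x) (f2 x) i)); exact: borel_carry.
apply: measurable_funM => //; apply: measurable_funD.
  apply: measurable_intr.
  by apply: (@borel_map_int_op2 _ _ (fun k l => k - l)); apply: mupper.
apply: (@measurable_sum _ _ _ _ _ _ (fun i x => \sum_j sec (tnth (tnth x (inord 0)) i)
  * (G i j)%:~R * (carry (tnth x (inord 1)) (tnth x (inord 2)) j)%:~R)) => i.
apply: (@measurable_sum _ _ _ _ _ _ (fun j x => sec (tnth (tnth x (inord 0)) i)
  * (G i j)%:~R * (carry (tnth x (inord 1)) (tnth x (inord 2)) j)%:~R)) => j.
apply: measurable_funM; last exact/measurable_intr/borel_carry.
apply: measurable_funM => //; apply: (measurableT_comp (@measurable_sec R)).
by apply: (measurableT_comp (measurable_tnth i)).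
Qed.

(** The differential of the real lift is integer valued, and [expi] kills the integers. *)
Lemma omega_proof (R : realType) n (G : 'M[int]_n)
    (symG : forall i j, G i j = G j i) (evenG : forall i, (2 %| G i i)%Z) :
  cocycle_pred (@torusM R n) (fun x => expi (omega_lift G x)).
Proof.
apply/asboolP; split=> [|g].
  apply/circle_borelP; apply: measurableT_comp; first exact: measurable_expi.
  exact: measurable_omega_lift.
rewrite -[LHS](raddf_cobord (@torusM R n) (@expi R)) omega_lift_cobord //.
exact: expi_int.
Qed.

Definition omega (R : realType) n (G : 'M[int]_n)
    (symG : forall i j, G i j = G j i) (evenG : forall i, (2 %| G i i)%Z) :=
  Cocycle (@omega_proof R n G symG evenG).

Lemma bockstein_omega (R : realType) n (G : 'M[int]_n)
    (symG : forall i j, G i j = G j i) (evenG : forall i, (2 %| G i i)%Z) :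
  bockstein (cclass (@omega R n G symG evenG)) =
  \sum_i cclass (wedge (gen_b R i) (gen_b R i)) *~ (G i i %/ 2)%Z
  + \sum_(i < n) \sum_(j < n | (i < j)%N)
      cclass (wedge (gen_b R i) (gen_b R j)) *~ G i j.
Proof.
(* The right-hand side is formed first among cocycles, to provide a representative; additivity of
   [cclass] and of evaluation then gives the class and the values. *)
pose z := \sum_i wedge (gen_b R i) (gen_b R i) *~ (G i i %/ 2)%Z
  + \sum_(i < n) \sum_(j < n | (i < j)%N) wedge (gen_b R i) (gen_b R j) *~ G i j.
rewrite (@bockstein3E _ _ _ z (@omega_lift R n G)) //.
- rewrite /z raddfD !raddf_sum /=; congr (_ + _).
    by apply: eq_bigr => i _; rewrite raddfMz.
  apply: eq_bigr => i _; rewrite raddf_sum.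
  by apply: eq_bigr => j _; rewrite raddfMz.
- exact: measurable_omega_lift.
- move=> x; rewrite omega_lift_cobord // -[z x]/(cocycle_eval x z); congr (_%:~R).
  rewrite /z raddfD !raddf_sum /=; congr (_ + _).
    by apply: eq_bigr => i _; rewrite raddfMz.
  apply: eq_bigr => i _; rewrite raddf_sum.
  by apply: eq_bigr => j _; rewrite raddfMz.
Qed.

(** * Lattice vectors, the bicharacter and the Gram matrix in coordinates *)

Lemma latticeE (R : realType) n (F : vectType R) (e : n.-tuple F) (m : 'I_n -> int) :
  lattice e (\sum_i (m i)%:~R *: tnth e i).
Proof. by exists m. Qed.

Lemma lattice_basis (R : realType) n (F : vectType R) (e : n.-tuple F) i k :
  lattice e (k%:~R *: tnth e i).
Proof.
exists (fun j => if j == i then k else 0); rewrite (bigD1 i) //= eqxx big1 ?addr0 //.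
by move=> j /negPf ->; rewrite scale0r.
Qed.

Lemma latticeD (R : realType) n (F : vectType R) (e : n.-tuple F) l l' :
  lattice e l -> lattice e l' -> lattice e (l + l').
Proof.
move=> [m ->] [m' ->]; exists (fun i => m i + m' i).
by rewrite -big_split; apply: eq_bigr => i _; rewrite rmorphD scalerDl.
Qed.

Lemma lattice_multiplicative (R : realType) (C : fieldType) n (F : vectType R)
    (e : n.-tuple F) (f : F -> C) (m : 'I_n -> int) :
  (forall l, lattice e l -> f l != 0) ->
  (forall l l', lattice e l -> lattice e l' -> f (l + l') = f l * f l') ->
  f (\sum_i (m i)%:~R *: tnth e i) = \prod_i f (tnth e i) ^ m i.
Proof.
move=> f0 fD.
have lat0 : lattice e 0.
  by exists (fun=> 0); rewrite big1 // => i _; rewrite scale0r.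
have f_0 : f 0 = 1.
  by apply: (mulfI (f0 _ lat0)); rewrite -fD // addr0 mulr1.
have fX i k : f (k%:~R *: tnth e i) = f (tnth e i) ^ k.
  have lati := lattice_basis e i.
  have nat j : f (j%:Z%:~R *: tnth e i) = f (tnth e i) ^+ j.
    elim: j => [|j IH]; first by rewrite scale0r f_0.
    rewrite intS rmorphD scalerDl fD; [|exact: lati|exact: lati].
    by rewrite IH exprS scale1r.
  case: k => j; first exact: nat.
  rewrite NegzE -exprnN -nat; apply: (mulfI (f0 _ (lati j.+1%:Z))).
  by rewrite -fD // -scalerDl -rmorphD subrr scale0r f_0 mulfV ?f0.
(* Membership in the lattice is carried through the induction because multiplicativity is assumed
   only there. *)
suff: lattice e (\sum_i (m i)%:~R *: tnth e i) /\
  f (\sum_i (m i)%:~R *: tnth e i) = \prod_i f (tnth e i) ^ m i by case.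
elim/big_ind2: _ => // [x1 x2 y1 y2 [l1 <-] [l2 <-]|i _].
  by split; [exact: latticeD|exact: fD].
by split; [exact: lattice_basis|exact: fX].
Qed.

(** Multiplicativity in each argument reduces the bicharacter to its basis values, where only pairs
    [i < j] give signs; this is the exponent [upperG]. *)
Lemma twist_bicharE (R : realType) n (F : vectType R) (e : n.-tuple F)
    (G : 'M[int]_n) (b : F -> F -> R[i]) (l m : 'I_n -> int) :
  twist_bichar e G b ->
  b (\sum_i (l i)%:~R *: tnth e i) (\sum_i (m i)%:~R *: tnth e i) =
  (-1) ^ upperG G l m.
Proof.
move=> [bpm bDl bDr be].
have b0 l' m' : lattice e l' -> lattice e m' -> b l' m' != 0.
  by move=> ll lm; have [->|->] := bpm _ _ ll lm; rewrite ?oppr_eq0 oner_eq0.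
have late i : lattice e (tnth e i).
  by rewrite -[tnth e i]scale1r; exact: (lattice_basis e i 1).
have N1 : (-1 : R[i]) != 0 by rewrite oppr_eq0 oner_eq0.
have sumX : {morph (fun k : int => (-1 : R[i]) ^ k) : k k' / k + k' >-> k * k'}.
  by move=> k k'; rewrite expfzDr.
have latm := latticeE e m.
rewrite (@lattice_multiplicative _ _ _ _ _ (fun x => b x _)); last 2 first.
- by move=> x lx; exact: b0.
- by move=> x y lx ly; exact: bDl.
rewrite /upperG (big_morph _ sumX (expr0z _)); apply: eq_bigr => i _.
rewrite (big_morph _ sumX (expr0z _)) lattice_multiplicative; last 2 first.
- by move=> x lx; exact: b0.
- by move=> x y lx ly; exact: bDr.
rewrite [RHS]big_mkcond /=.
rewrite (big_morph (fun x : R[i] => x ^ l i) (fun x y => expfzMl x y _) (exp1rz _ (l i))).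
apply: eq_bigr => j _; rewrite be; case: ifP => _; last by rewrite !exp1rz.
by rewrite !exprz_exp; congr (_ ^ _); ring.
Qed.

Lemma dot_secF_carryF (R : realType) n (F : vectType R)
    (dotF : {dot F for idfun}) (e : n.-tuple F) (G : 'M[int]_n)
    (G_gram : forall i j, (G i j)%:~R = dotF (tnth e i) (tnth e j))
    (q r t : torus R n) :
  dotF (secF e q) (carryF e r t) =
  formG G (fun i => sec (tnth q i)) (fun i => (carry r t i)%:~R).
Proof.
rewrite /secF linear_sumlz; apply: eq_bigr => i _.
rewrite linearZl_LR linear_sumr mulr_sumr; apply: eq_bigr => j _.
by rewrite linearZr_LR /= G_gram mulrA mulrAC.
Qed.

Lemma even_lattice_diag (R : realType) n (F : vectType R)
    (dotF : {dot F for idfun}) (e : n.-tuple F) (G : 'M[int]_n)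
    (L_even : even_lattice dotF e)
    (G_gram : forall i j, (G i j)%:~R = dotF (tnth e i) (tnth e j)) i :
  (2 %| G i i)%Z.
Proof.
have [k] := L_even _ (lattice_basis e i 1).
by rewrite scale1r -G_gram => /intr_inj ->; exact: dvdz_mulr.
Qed.

Lemma gram_sym (R : realType) n (F : vectType R)
    (dotF : {dot F for idfun}) (e : n.-tuple F) (G : 'M[int]_n)
    (G_gram : forall i j, (G i j)%:~R = dotF (tnth e i) (tnth e j)) i j :
  G i j = G j i.
Proof.
by apply: (@intr_inj R); rewrite !G_gram hermC expr0 mul1r.
Qed.

(** * Operator relations in the crossed product and the obstruction *)

Lemma commutant_id (R : realType) (H : hilbertSpace R) (S : set (op H)) :
  commutant S id.
Proof.
split=> //; split=> //; by exists 1 => x; rewrite mul1r.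
Qed.

(** By surjectivity some [B] maps to the identity, and then [alpha(1) = alpha(1) alpha(B) = alpha(B)
    = 1]. *)
Lemma vN_automorphism_id (R : realType) (H : hilbertSpace R) (M : set (op H))
    alpha : M id -> vN_automorphism M alpha -> alpha id = id.
Proof.
move=> M1 [[_ _ surj] _ alphaM _].
have [B MB B1] := surj _ M1.
by have := alphaM _ _ M1 MB; rewrite B1 => /esym.
Qed.

Lemma scale_opA (R : realType) (H : hilbertSpace R) (c d : R[i]) (A : op H) :
  scale_op c (scale_op d A) = scale_op (c * d) A.
Proof. by apply/funext => x; rewrite /scale_op scalerA. Qed.

Lemma scale_unitary_inj (R : realType) (H : hilbertSpace R) (c d : R[i])
    (U : op H) (x : H) :
  x != 0 -> unitary_op U -> scale_op c U = scale_op d U -> c = d.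
Proof.
move=> x0 [_ _ /(_ x)[y Uy]] /(congr1 (@^~ y)); rewrite /scale_op Uy.
move/eqP; rewrite -subr_eq0 -scalerBl scaler_eq0 (negPf x0) orbF subr_eq0.
by move/eqP.
Qed.

Lemma smooth_loop0 (R : realType) n (F : vectType R) (e : n.-tuple F) :
  smooth_loop e (fun=> 0).
Proof.
move=> j; rewrite (_ : loop_coord _ _ _ = cst 0); last first.
  by apply/funext => x; rewrite /loop_coord linear0.
split=> // k x.
have -> : derive1n k (cst 0 : R -> R) = cst 0.
  elim: k => // k IH; rewrite derive1nS IH; apply/funext => y.
  exact: derive1_cst.
exact: derivable_cst.
Qed.

(** The vacuum expectation of the Weyl operator at 0 is a real exponential, so the vacuum and its
    isometric image are nonzero. Scalars can then be read off from operator equations. *)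
Lemma kernel_data_nonzero (R : realType) n (F : vectType R)
    (dotF : {dot F for idfun}) (e : n.-tuple F) (G : 'M[int]_n) (a b : R)
    (l0 : R -> R) (D : kernel_data dotF e G a b l0) :
  exists x : kK D, x != 0.
Proof.
have [_ _ vacW _] := kWP D; have [_ _ _ _ [V [_ Visom _ _ _]]] := kAL_rep D.
exists (V (kvac D)); apply/eqP => V0.
have := vacW _ (smooth_loop0 e); rewrite -Visom V0 linear0l.
move/(congr1 (@complex.Re R)) => /= /esym/eqP.
by rewrite gt_eqF // expR_gt0.
Qed.

(** The defining formula of [kbeta] at the identity of [kAF], which both [krho] and [kiota]
    preserve. *)
Lemma kbeta_psi (R : realType) n (F : vectType R)
    (dotF : {dot F for idfun}) (e : n.-tuple F) (G : 'M[int]_n) (a b : R)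
    (l0 : R -> R) (D : kernel_data dotF e G a b l0) t m :
  lattice e m ->
  kbeta D t (kpsi D m) = scale_op (cis (pi * dotF t m)) (kpsi D m).
Proof.
move=> lm; have M1 : kAF (k := D) id by exact: commutant_id.
have := kbetaE t M1 lm; have [[_ iota1 _ _ _] _ _ _ _] := kAL_rep D.
by rewrite (vN_automorphism_id M1 (krho_aut D t)) iota1.
Qed.

(** Both sides of the obstruction relation are multiples of the same unitary [kpsi], by the cocycle
    relation of the carry. The automorphism contributes the phase [e^(i pi <s(q), c(r,t)>)], the
    bicharacter both signs, and comparing scalars gives [omegaG]. *)
Lemma obstruction_cocycleE (R : realType) n (F : vectType R)
    (dotF : {dot F for idfun}) (e : n.-tuple F) (G : 'M[int]_n)
    (G_gram : forall i j, (G i j)%:~R = dotF (tnth e i) (tnth e j))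
    (a b : R) (l0 : R -> R) (D : kernel_data dotF e G a b l0)
    (om : torus R n -> torus R n -> torus R n -> circle R) :
  obstruction_cocycle D (fun x => kbeta D (secF e x))
    (fun x y => kpsi D (carryF e x y)) om <->
  (forall q r t, cval (om q r t) = omegaG G q r t).
Proof.
have [x0 x0_neq0] := kernel_data_nonzero D.
have [_ psiU _ psiM _] := kAL_rep D.
have lat q r : lattice e (carryF e q r) by exact: latticeE.
have N1 k : (-1 : R[i]) ^ k != 0 by rewrite expfz_neq0 // oppr_eq0 oner_eq0.
have signV k : ((-1 : R[i]) ^ k)^-1 = (-1) ^ k by rewrite invr_expz -exprz_inv invrN1.
have psi_comp c q r q' r' :
    scale_op c (kpsi D (carryF e q r)) \o kpsi D (carryF e q' r') =
    scale_op (c * (-1) ^ upperG G (carry q r) (carry q' r'))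
      (kpsi D (carryF e q r + carryF e q' r')).
  rewrite -scale_opA -(twist_bicharE _ _ (kbP D)) -psiM //; exact: latticeE.
have carryF_assoc q r t : carryF e q r + carryF e (torusM q r) t =
    carryF e r t + carryF e q (torusM r t).
  rewrite /carryF -!big_split; apply: eq_bigr => i _ /=.
  by rewrite -!scalerDl -!rmorphD (carry_assoc q r t) subrK.
have scale_comp c q r q' r' :
    scale_op c (kpsi D (carryF e q r) \o kpsi D (carryF e q' r')) =
    scale_op c (kpsi D (carryF e q r)) \o kpsi D (carryF e q' r') by [].
have key q r t (c : R[i]) :
    kbeta D (secF e q) (kpsi D (carryF e r t)) \o kpsi D (carryF e q (torusM r t)) =
    scale_op c (kpsi D (carryF e q r) \o kpsi D (carryF e (torusM q r) t)) <->
    c = omegaG G q r t.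
  rewrite kbeta_psi // scale_comp !psi_comp -carryF_assoc.
  rewrite (dot_secF_carryF G_gram) /omegaG expfzDr ?oppr_eq0 ?oner_eq0 //.
  rewrite -invr_expz signV.
  set A := (-1) ^ upperG _ _ _; set B := (-1) ^ upperG _ _ _; set C := cis _.
  (* A sign is its own inverse, so it can be moved across the equation of scalars. *)
  have BB : B * B = 1 by rewrite -{1}[B]signV mulVf.
  split=> [/(scale_unitary_inj x0_neq0 (psiU _ (latticeD (lat _ _) (lat _ _)))) eqU|->].
    by rewrite -[LHS]mulr1 -BB mulrA -eqU; ring.
  by congr scale_op; rewrite -[LHS]mulr1 -BB; ring.
split=> obs q r t; first exact/key/obs.
exact/key.
Qed.

Theorem proposition5p4 (R : realType) (n : nat) (F : vectType R)
    (dotF : {dot F for idfun}) (e : n.-tuple F) (G : 'M[int]_n)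
    (e_basis : basis_of {:F} e) (L_even : even_lattice dotF e)
    (G_gram : forall i j, (G i j)%:~R = dotF (tnth e i) (tnth e j)) :
  exists w : cocycle (@torusM R n) (circle R) 3,
  [/\ forall q r t, cval (w [tuple q; r; t]) = omegaG G q r t,
      forall (a b : R) (l0 : R -> R),
        a < b < a + 2 * pi -> smooth_periodic l0 ->
        supported_in l0 (circle_arc a b) -> mean l0 = 1 ->
        forall D : kernel_data dotF e G a b l0,
        let alpha x := kbeta D (secF e x) in
        let u x y := kpsi D (carryF e x y) in
        kernel_lift D alpha u ->
        forall om, obstruction_cocycle D alpha u om <->
          (forall q r t, om q r t = w [tuple q; r; t])
    & bockstein (cclass w) =
        \sum_i cclass (wedge (gen_b R i) (gen_b R i)) *~ (G i i %/ 2)%Z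
        + \sum_(i < n) \sum_(j < n | (i < j)%N)
            cclass (wedge (gen_b R i) (gen_b R j)) *~ G i j].
Proof.
have symG := gram_sym G_gram; have evenG := even_lattice_diag L_even G_gram.
(* The witness is the exponential of the explicit lift; the operator relation forces [om] to have
   the same complex values. *)
exists (omega R symG evenG); split; last exact: bockstein_omega.
  exact: expi_omega_lift.
move=> a b l0 _ _ _ _ D alpha u _ om.
have obsE := obstruction_cocycleE G_gram D om.
split=> [/obsE omE q r t|omE].
  by apply: val_inj; rewrite /= omE -expi_omega_lift.
by apply/obsE => q r t; rewrite omE expi_omega_lift.
Qed.
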